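(* $$\sum_{k=1}^\infty\frac{S_1(2k)+\frac{2}{3k}}{k^2\binom{2k}{k}}=\zeta_3.$$
   Context: $S_1(n):=\sum_{i=1}^n \frac1i$ is the $n$-th harmonic number, and $\zeta_3:=\sum_{i=1}^\infty \frac{1}{i^3}$. *)

(* Defs.v *)
From Stdlib Require Import Reals.
From Coquelicot Require Import Coquelicot.
Open Scope R_scope.

Definition S1 (n : nat) : R := sum_n_m (fun i => 1 / INR i) 1 n.

(* [Series] sums from index 0, so the index is shifted by one. *)
Definition zeta3 : R := Series (fun i => 1 / INR (S i) ^ 3).

(* The qualified name is needed: Coquelicot's [C] is the type of complex
   numbers, which shadows the binomial coefficient of the standard library. *)
Definition binom (n k : nat) : R := Binomial.C n k.

Definition summand (k : nat) : R :=
  (S1 (2 * k) + 2 / (3 * INR k)) / (INR k ^ 2 * binom (2 * k) k).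

(* Main.v *)
Require Import Defs.
From Stdlib Require Import Reals.
From Coquelicot Require Import Coquelicot.
From Stdlib Require Import Factorial Lra Lia.
Open Scope R_scope.

(** The proof exhibits a Wilf-Zeilberger pair, that is, a closed discrete
    1-form on the quarter plane.  Write [H] for the harmonic numbers and
    [w n m] for the inverse of the binomial coefficient of [n + m] over [n].
    The step from [(n - 1, m)] to [(n, m)] carries the weight
      [F n m = w n m / n^2 * (H_m - H_n + H_(n+m) + 3/n)],
    and the step from [(n, m - 1)] to [(n, m)] carries
      [G n m = w n m / m^2 * (H_m - H_n + H_(n+m) - 1/m)].
    Both ways around a unit square have the same total weight ([wz_square]),
    so the weight of a lattice path depends on its endpoints only.

    Two paths from the origin to [(N, N)] are compared.  The path along the
    horizontal axis and then up has weight [3 * sum 1/n^3], as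
    [F n 0 = 3/n^3], plus the weight of its vertical part, which is [O(1/N)]
    ([vertical_sum_bound]).  On the staircase that follows the diagonal,
    [H_m - H_n] is zero up to one term, so only [H_(2k)] survives, and the
    steps from [(k-1, k-1)] to [(k, k)] weigh [3 * summand k]
    ([diagonal_step]).

    The pair is the sum of two pairs with potentials built on the iterated
    integral [J] of [t^n (1-u)^m dt/(1-t) du/u] over [0 < t < u < 1], a
    two-sided tail of zeta(2); the weight of a step is the drop of the
    potential.  One potential is minus the derivative of [J] in [n], with axis
    weight [2/n^3].  The other is [I + H_m J], with axis weight [1/n^3], where
    [I] is the integral of [t^n (1-v)^m dt/(1-t) du/u dv/v] over
    [0 < t < u < v < 1], a tail of zeta(3).  Adding them cancels [H_k] on the
    diagonal. *)

(** * Harmonic numbers and inverse binomial coefficients *)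

Lemma S1_0 : S1 0 = 0.
Proof. unfold S1. now rewrite sum_n_m_zero by lia. Qed.

Lemma S1_S (n : nat) : S1 (S n) = S1 n + 1 / INR (S n).
Proof. unfold S1. now rewrite sum_n_Sm by lia. Qed.

Lemma inv_INR_S_bounds (n : nat) : 0 < 1 / INR (S n) <= 1.
Proof.
  rewrite S_INR. pose proof (pos_INR n). split.
  - apply Rdiv_lt_0_compat; lra.
  - apply Rle_div_l; lra.
Qed.

Lemma S1_add_bounds (n m : nat) : 0 <= S1 (n + m) - S1 n <= INR m.
Proof.
  induction m as [|m IH].
  - rewrite Nat.add_0_r. simpl. lra.
  - rewrite Nat.add_succ_r, S1_S, (S_INR m).
    pose proof (inv_INR_S_bounds (n + m)). lra.
Qed.

Lemma S1_bounds (n : nat) : 0 <= S1 n <= INR n.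
Proof. pose proof (S1_add_bounds 0 n) as H. rewrite S1_0, Nat.add_0_l in H. lra. Qed.

Definition inv_binom (n m : nat) : R :=
  INR (fact n) * INR (fact m) / INR (fact (n + m)).

Lemma inv_binom_pos (n m : nat) : 0 < inv_binom n m.
Proof.
  unfold inv_binom.
  apply Rdiv_lt_0_compat; [apply Rmult_lt_0_compat|]; apply INR_fact_lt_0.
Qed.

Lemma inv_binom_0_r (n : nat) : inv_binom n 0 = 1.
Proof.
  unfold inv_binom. rewrite Nat.add_0_r. simpl. field. apply INR_fact_neq_0.
Qed.

Lemma inv_binom_S_l (n m : nat) :
  inv_binom (S n) m = inv_binom n m * (INR n + 1) / (INR n + INR m + 1).
Proof.
  unfold inv_binom. rewrite Nat.add_succ_l, !fact_simpl, !mult_INR, !S_INR, plus_INR.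
  pose proof (pos_INR n). pose proof (pos_INR m).
  field. split; [apply INR_fact_neq_0|lra].
Qed.

Lemma inv_binom_S_r (n m : nat) :
  inv_binom n (S m) = inv_binom n m * (INR m + 1) / (INR n + INR m + 1).
Proof.
  unfold inv_binom. rewrite Nat.add_succ_r, !fact_simpl, !mult_INR, !S_INR, plus_INR.
  pose proof (pos_INR n). pose proof (pos_INR m).
  field. split; [apply INR_fact_neq_0|lra].
Qed.

Lemma inv_binom_decr_r (n m : nat) : inv_binom n (S m) <= inv_binom n m.
Proof.
  rewrite inv_binom_S_r. pose proof (inv_binom_pos n m).
  pose proof (pos_INR n). pose proof (pos_INR m).
  apply Rle_div_l; [lra|]. apply Rmult_le_compat_l; lra.
Qed.

Lemma inv_binom_diag (k : nat) : inv_binom k k = / binom (2 * k) k.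
Proof.
  unfold inv_binom, binom, Binomial.C.
  replace (2 * k - k)%nat with k by lia. replace (2 * k)%nat with (k + k)%nat by lia.
  field. repeat split; apply INR_fact_neq_0.
Qed.

(** * The closed 1-form *)

Definition wz_horiz (n m : nat) : R :=
  inv_binom n m / INR n ^ 2 * (S1 m - S1 n + S1 (n + m) + 3 / INR n).

Definition wz_vert (n m : nat) : R :=
  inv_binom n m / INR m ^ 2 * (S1 m - S1 n + S1 (n + m) - 1 / INR m).

Lemma wz_square (n m : nat) :
  wz_horiz (S n) m + wz_vert (S n) (S m) = wz_vert n (S m) + wz_horiz (S n) (S m).
Proof.
  unfold wz_horiz, wz_vert.
  rewrite (inv_binom_S_r (S n)), !(inv_binom_S_l n), inv_binom_S_r.
  rewrite !Nat.add_succ_r, !Nat.add_succ_l, !S1_S, !S_INR, !plus_INR.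
  pose proof (pos_INR n). pose proof (pos_INR m).
  field. repeat split; lra.
Qed.

Lemma wz_horiz_axis (n : nat) : wz_horiz (S n) 0 = 3 * (1 / INR (S n) ^ 3).
Proof.
  unfold wz_horiz. rewrite inv_binom_0_r, Nat.add_0_r, S1_0.
  pose proof (pos_INR n). rewrite S_INR. field. lra.
Qed.

Lemma diagonal_step (k : nat) :
  wz_horiz (S k) k + wz_vert (S k) (S k) = 3 * summand (S k).
Proof.
  unfold summand, Rdiv at 1. rewrite Rinv_mult, <- inv_binom_diag.
  unfold wz_horiz, wz_vert.
  rewrite (inv_binom_S_r (S k)).
  replace (2 * S k)%nat with (S (S (k + k))) by lia.
  rewrite Nat.add_succ_r, Nat.add_succ_l, !S1_S, !S_INR, !plus_INR.
  pose proof (pos_INR k). field. repeat split; lra.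
Qed.

Lemma wz_rectangle (n M : nat) :
  wz_horiz (S n) 0 + sum_n (fun m => wz_vert (S n) (S m)) M =
  sum_n (fun m => wz_vert n (S m)) M + wz_horiz (S n) (S M).
Proof.
  induction M as [|M IH].
  - rewrite !sum_O. apply wz_square.
  - rewrite !sum_Sn. unfold plus; simpl.
    pose proof (wz_square n (S M)). lra.
Qed.

Lemma axis_path_eq_diagonal_path (N : nat) :
  sum_n (fun n => wz_horiz (S n) 0) N + sum_n (fun m => wz_vert (S N) (S m)) N =
  sum_n (fun k => wz_horiz (S k) k + wz_vert (S k) (S k)) N.
Proof.
  induction N as [|N IH].
  - now rewrite !sum_O.
  - rewrite !sum_Sn. unfold plus; simpl. rewrite <- IH.
    pose proof (wz_rectangle (S N) N). lra.
Qed.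

(** * The vertical part vanishes in the limit *)

Lemma inv_binom_le_2 (n m : nat) :
  inv_binom n (S (S m)) <= 2 / ((INR n + 1) * (INR n + 2)).
Proof.
  induction m as [|m IH].
  - rewrite !inv_binom_S_r, inv_binom_0_r. simpl. pose proof (pos_INR n).
    right. field. split; lra.
  - eapply Rle_trans; [apply inv_binom_decr_r|exact IH].
Qed.

(** The bracket grows at most linearly in the height, which the factor
    [1 / m ^ 2] absorbs; the inverse binomial coefficient gives the square
    decay in [n].  At height 1 that coefficient is only [1 / (n + 1)], but the
    bracket equals [1 / (n + 1)] there. *)
Lemma wz_vert_bounds (n m : nat) :
  0 <= wz_vert n (S m) <= 4 / (INR n + 1) ^ 2.
Proof.
  unfold wz_vert. pose proof (pos_INR n) as Hn.
  destruct m as [|m].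
  - rewrite inv_binom_S_r, inv_binom_0_r, Nat.add_1_r, !S1_S, S1_0, !S_INR.
    simpl INR.
    match goal with |- 0 <= ?x <= _ =>
      replace x with (1 / (INR n + 1) ^ 2) by (field; lra) end.
    assert (0 < / (INR n + 1) ^ 2) by (apply Rinv_0_lt_compat, pow_lt; lra).
    unfold Rdiv. lra.
  - set (p := S m).
    rewrite (S1_S p).
    pose proof (S1_bounds p). pose proof (S1_add_bounds n (S p)).
    pose proof (inv_binom_le_2 n m) as Hw. pose proof (inv_binom_pos n (S p)) as Hw0.
    fold p in Hw.
    assert (Hp : 1 <= INR p) by (unfold p; rewrite S_INR; pose proof (pos_INR m); lra).
    rewrite S_INR in *.
    set (b := S1 p + 1 / (INR p + 1) - S1 n + S1 (n + S p) - 1 / (INR p + 1)).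
    assert (Hb : 0 <= b <= 2 * (INR p + 1)) by (unfold b; lra).
    assert (Hq : 0 <= b / (INR p + 1) ^ 2 <= 2).
    { assert (0 < (INR p + 1) ^ 2) by (apply pow_lt; lra). split.
      - apply Rdiv_le_0_compat; lra.
      - apply Rle_div_l; nra. }
    replace (inv_binom n (S p) / (INR p + 1) ^ 2 * b)
      with (inv_binom n (S p) * (b / (INR p + 1) ^ 2)) by (field; lra).
    split; [apply Rmult_le_pos; lra|].
    apply Rle_trans with (2 / ((INR n + 1) * (INR n + 2)) * 2).
    + apply Rmult_le_compat; lra.
    + replace (4 / (INR n + 1) ^ 2) with (2 / (INR n + 1) ^ 2 * 2) by (field; lra).
      apply Rmult_le_compat_r; [lra|]. unfold Rdiv. apply Rmult_le_compat_l; [lra|].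
      apply Rinv_le_contravar; [apply pow_lt|]; nra.
Qed.

Lemma vertical_sum_bound (N : nat) :
  0 <= sum_n (fun m => wz_vert (S N) (S m)) N <= 4 / INR (S N).
Proof.
  assert (H : forall M, 0 <= sum_n (fun m => wz_vert (S N) (S m)) M
                        <= INR (S M) * (4 / (INR (S N) + 1) ^ 2)).
  { induction M as [|M IH].
    - rewrite sum_O. pose proof (wz_vert_bounds (S N) 0). simpl INR at 1. lra.
    - rewrite sum_Sn, (S_INR (S M)). unfold plus; simpl plus.
      pose proof (wz_vert_bounds (S N) (S M)). simpl in *. lra. }
  specialize (H N). split; [lra|]. eapply Rle_trans; [apply H|].
  assert (0 < INR (S N)) by (apply lt_0_INR; lia).
  set (x := INR (S N)) in *.
  replace (x * (4 / (x + 1) ^ 2)) with (4 / ((x + 1) ^ 2 / x)) by (field; lra).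
  unfold Rdiv at 1 3. apply Rmult_le_compat_l; [lra|].
  apply Rinv_le_contravar; [lra|]. apply Rle_div_r; nra.
Qed.

Lemma vertical_sum_lim :
  is_lim_seq (fun N => sum_n (fun m => wz_vert (S N) (S m)) N) 0.
Proof.
  apply is_lim_seq_le_le with (u := fun _ => 0) (w := fun N => 4 / INR (S N)).
  - exact vertical_sum_bound.
  - apply is_lim_seq_const.
  - unfold Rdiv. replace (Finite 0) with (Rbar_mult 4 (Rbar_inv p_infty))
      by (simpl; f_equal; ring).
    apply is_lim_seq_scal_l, is_lim_seq_inv; [|discriminate].
    apply -> is_lim_seq_incr_1. apply is_lim_seq_INR.
Qed.

(** * Conclusion *)

(** The partial sums increase and stay below [2 - 1 / (N + 1)]. *)
Lemma is_series_zeta3 : is_series (fun i => 1 / INR (S i) ^ 3) zeta3.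
Proof.
  apply Series_correct.
  assert (Hpos : forall i, 0 < INR (S i)) by (intro; apply lt_0_INR; lia).
  destruct (ex_finite_lim_seq_incr (sum_n (fun i => 1 / INR (S i) ^ 3)) 2) as [l Hl].
  - intro N. rewrite sum_Sn. unfold plus; simpl plus.
    assert (0 < 1 / INR (S (S N)) ^ 3)
      by (apply Rdiv_lt_0_compat; [lra|apply pow_lt, Hpos]).
    simpl in *. lra.
  - intro N.
    enough (sum_n (fun i => 1 / INR (S i) ^ 3) N <= 2 - 1 / INR (S N)).
    { assert (0 < 1 / INR (S N)) by (apply Rdiv_lt_0_compat; [lra|apply Hpos]). lra. }
    induction N as [|N IH].
    + rewrite sum_O. simpl. lra.
    + rewrite sum_Sn, (S_INR (S N)). unfold plus; simpl plus.
      pose proof (Hpos N). set (x := INR (S N)) in *.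
      assert (E : 1 / x - 1 / (x + 1) - 1 / (x + 1) ^ 3
                  = (x ^ 2 + x + 1) / (x * (x + 1) ^ 3)) by (field; lra).
      assert (0 < (x ^ 2 + x + 1) / (x * (x + 1) ^ 3)).
      { apply Rdiv_lt_0_compat; [nra|].
        apply Rmult_lt_0_compat; [lra|apply pow_lt; lra]. }
      change (sum_n (fun i => 1 / INR (S i) ^ 3) N + 1 / (x + 1) ^ 3
              <= 2 - 1 / (x + 1)).
      lra.
  - now exists l.
Qed.

Theorem mainTheorem6 : is_series (fun n : nat => summand (S n)) zeta3.
Proof.
  change (is_lim_seq (sum_n (fun n => summand (S n))) zeta3).
  apply (is_lim_seq_ext
    (fun N => sum_n (fun i => 1 / INR (S i) ^ 3) N
              + / 3 * sum_n (fun m => wz_vert (S N) (S m)) N)).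
  - intro N. pose proof (axis_path_eq_diagonal_path N) as E.
    rewrite (sum_n_ext _ _ N wz_horiz_axis), (sum_n_ext _ _ N diagonal_step) in E.
    rewrite !(sum_n_mult_l (K := R_Ring) 3) in E.
    assert (H : forall a b c : R, 3 * a + b = 3 * c -> a + / 3 * b = c)
      by (intros; lra).
    exact (H _ _ _ E).
  - replace (Finite zeta3) with (Finite (zeta3 + / 3 * 0)) by (f_equal; ring).
    apply is_lim_seq_plus'; [exact is_series_zeta3|].
    apply (is_lim_seq_scal_l _ (/ 3) 0), vertical_sum_lim.
Qed.
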